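(* Let $f:\mathbb{C}\to\mathbb{C}$ be a transcendental entire function omitting a point $a\in\mathbb{C}$ (that is, $f(z)\neq a$ for all $z\in\mathbb{C}$), and let $D\subset\mathbb{C}$ be a simply connected region that does not contain $a$. Then the full preimage $f^{-1}(D)$ is disconnected.
   Context: A region is a non-empty connected open subset of $\mathbb{C}$. An entire function is transcendental if it is not a polynomial. *)

(* Defs.v *)
From Stdlib Require Import Reals.
From Coquelicot Require Import Coquelicot.
Open Scope R_scope.

(* Connectedness in the subspace topology; the empty set counts as connected. *)
Definition connected_set {T : UniformSpace} (S : T -> Prop) : Prop :=
  forall U V : T -> Prop,
    open U -> open V ->
    (forall x, S x -> U x \/ V x) ->
    (exists x, S x /\ U x) ->
    (exists x, S x /\ V x) ->
    exists x, S x /\ U x /\ V x.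

Definition unit_interval (t : R) : Prop := 0 <= t <= 1.

Definition unit_square (p : R * R) : Prop :=
  unit_interval (fst p) /\ unit_interval (snd p).

(* Values outside [0,1] are irrelevant: [continuous_on] is relative continuity. *)
Definition is_path_in (D : C -> Prop) (x y : C) (g : R -> C) : Prop :=
  continuous_on unit_interval g /\
  (forall t, unit_interval t -> D (g t)) /\
  g 0 = x /\ g 1 = y.

(* [H (s, t)]: [s] is the deformation parameter, [t] runs along the loop; the
   base point [x] stays fixed throughout the deformation. *)
Definition null_homotopic_in (D : C -> Prop) (x : C) (g : R -> C) : Prop :=
  exists H : R * R -> C,
    continuous_on unit_square H /\
    (forall p, unit_square p -> D (H p)) /\
    (forall t, unit_interval t -> H (0, t) = g t) /\
    (forall t, unit_interval t -> H (1, t) = x) /\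
    (forall s, unit_interval s -> H (s, 0) = x /\ H (s, 1) = x).

Definition simply_connected (D : C -> Prop) : Prop :=
  (forall x y, D x -> D y -> exists g, is_path_in D x y g) /\
  (forall x g, is_path_in D x x g -> null_homotopic_in D x g).

(* [open] refers to the product topology on C = R * R, i.e. the usual one. *)
Definition region (D : C -> Prop) : Prop :=
  (exists z, D z) /\ open (T := C_UniformSpace) D /\
  connected_set (T := C_UniformSpace) D.

(* [ex_derive] over the field C is complex differentiability. *)
Definition entire (f : C -> C) : Prop :=
  forall z, ex_derive (K := C_AbsRing) (V := C_NormedModule) f z.

Definition polynomial_function (f : C -> C) : Prop :=
  exists (n : nat) (a : nat -> C),
    forall z, f z = sum_n (fun k => (a k * z ^ k)%C) n.

Definition transcendental_entire (f : C -> C) : Prop :=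
  entire f /\ ~ polynomial_function f.

(* Main.v *)
(* A logarithm g of f - a is entire, by lifting through exp.  The open set
   E = {u | a + exp u in D} splits into the path component E0 of a point c and its
   complement E1; both are open, and simple connectedness of D puts c + 2 pi i in
   E1.  If the preimage of D under f, which is the preimage of E under g, were
   connected, then g would omit E0 or E1, hence be constant by Liouville's theorem
   applied to 1/(g - c'), and f would be constant. *)

Require Import Defs.
From Stdlib Require Import Reals.
From Coquelicot Require Import Coquelicot.
From Stdlib Require Import Ranalysis5 Lra Classical ClassicalEpsilon.
Open Scope R_scope.

(** That a non-constant entire function cannot omit two single values is Picard's theorem. Here [g]
    would omit a non-empty open set, hence a disc, so the reciprocal is bounded and Liouville is
    enough. This is why both pieces of E have to be open and non-empty. The translation by 2 pi i is
    a deck transformation of [a + exp] over the plane without a. A path in E from c to c + 2 pi i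
    would project to a loop in D that winds once around a, and such a loop cannot contract in D
    because a lies outside D. Existence of continuous logarithms on the plane is used twice: for
    [f - a], and for the null-homotopy, which is first extended from the unit square to the plane by
    a retraction. The matching uniqueness statement is that a path along which exp is constant has
    equal end points; it replaces winding numbers throughout. The only Cauchy theory behind
    Liouville is Goursat's theorem for rectangles. *)

Notation contC := (@continuous _ C_UniformSpace).

(** * The complex exponential *)

Lemma Cmod_le_abs (z : C) : Cmod z <= Rabs (fst z) + Rabs (snd z).
Proof.
  replace z with ((fst z, 0) + (0, snd z))%C at 1.
  - eapply Rle_trans; [apply Cmod_triangle|].
    apply Req_le; f_equal; unfold Cmod; simpl.
    + rewrite <- sqrt_Rsqr_abs; f_equal; unfold Rsqr; ring.
    + rewrite <- sqrt_Rsqr_abs; f_equal; unfold Rsqr; ring.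
  - destruct z; unfold Cplus; simpl; f_equal; ring.
Qed.

Lemma abs_fst_le_Cmod (z : C) : Rabs (fst z) <= Cmod z.
Proof. eapply Rle_trans; [|apply Rmax_Cmod]; apply Rmax_l. Qed.

Lemma abs_snd_le_Cmod (z : C) : Rabs (snd z) <= Cmod z.
Proof. eapply Rle_trans; [|apply Rmax_Cmod]; apply Rmax_r. Qed.

(** Balls of the product structure on [C] are squares. Discs and squares fit into each other up to a
    factor 2, whence the [d / 2]. *)
Lemma locally_Cmod (z : C) (P : C -> Prop) :
  locally (T := C_UniformSpace) z P <->
  exists d, 0 < d /\ forall y, Cmod (y - z) < d -> P y.
Proof.
  split.
  - intros [d H]; exists d; split; [apply cond_pos|].
    intros y Hy; apply H; split; change (Rabs (fst y - fst z) < d) || change (Rabs (snd y - snd z) < d).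
    + eapply Rle_lt_trans; [apply (abs_fst_le_Cmod (y - z)%C)|exact Hy].
    + eapply Rle_lt_trans; [apply (abs_snd_le_Cmod (y - z)%C)|exact Hy].
  - intros (d & Hd & H).
    exists (mkposreal (d / 2) ltac:(lra)); intros y [H1 H2]; apply H.
    change (Rabs (fst y - fst z) < d / 2) in H1.
    change (Rabs (snd y - snd z) < d / 2) in H2.
    eapply Rle_lt_trans; [apply Cmod_le_abs|].
    change (Rabs (fst y - fst z) + Rabs (snd y - snd z) < d); lra.
Qed.


Lemma continuous_C_eps {T : UniformSpace} (f : T -> C) (x : T) :
  contC f x <->
  forall e, 0 < e -> locally x (fun y => Cmod (f y - f x) < e).
Proof.
  split.
  - intros H e He; apply (H (fun z => Cmod (z - f x) < e)), locally_Cmod; exists e; auto.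
  - intros H P HP; apply locally_Cmod in HP; destruct HP as (d & Hd & HP).
    unfold filtermap; eapply filter_imp; [|apply (H d Hd)]; auto.
Qed.

(** * Continuity of complex-valued maps *)

Section ContinuousC.
Context {T : UniformSpace}.
Implicit Types (f g : T -> C) (x : T).

Lemma continuous_C f x :
  continuous (fun t => fst (f t)) x -> continuous (fun t => snd (f t)) x ->
  contC f x.
Proof.
  intros H1 H2.
  apply (continuous_ext (fun t => (fst (f t), snd (f t)) : C_UniformSpace)).
  - intros t; destruct (f t); reflexivity.
  - exact (continuous_comp_2 (fun t => fst (f t)) (fun t => snd (f t)) (fun a b => (a, b) : C_UniformSpace) x H1 H2
      (continuous_ext _ _ _ (fun p : prod_UniformSpace R_UniformSpace R_UniformSpace => surjective_pairing p) (continuous_id _))).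
Qed.

Lemma continuous_Re f x : contC f x -> continuous (fun t => fst (f t)) x.
Proof. intros H; apply (continuous_comp f fst); [exact H|apply continuous_fst]. Qed.

Lemma continuous_Im f x : contC f x -> continuous (fun t => snd (f t)) x.
Proof. intros H; apply (continuous_comp f snd); [exact H|apply continuous_snd]. Qed.

Lemma continuous_Cplus f g x :
  contC f x -> contC g x -> contC (fun t => f t + g t)%C x.
Proof. exact (@continuous_plus _ C_AbsRing C_NormedModule f g x). Qed.

Lemma continuous_Copp f x : contC f x -> contC (fun t => - f t)%C x.
Proof. exact (@continuous_opp _ C_AbsRing C_NormedModule f x). Qed.

Lemma continuous_Cminus f g x :
  contC f x -> contC g x -> contC (fun t => f t - g t)%C x.
Proof. exact (@continuous_minus _ C_AbsRing C_NormedModule f g x). Qed.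

Lemma continuous_Rmult (u v : T -> R) x :
  continuous u x -> continuous v x -> continuous (fun t => u t * v t) x.
Proof. exact (@continuous_mult T R_AbsRing u v x). Qed.

Lemma continuous_Cmult f g x :
  contC f x -> contC g x -> contC (fun t => f t * g t)%C x.
Proof.
  intros Hf Hg.
  pose proof (continuous_Re _ _ Hf); pose proof (continuous_Im _ _ Hf).
  pose proof (continuous_Re _ _ Hg); pose proof (continuous_Im _ _ Hg).
  apply continuous_C; simpl.
  - apply (@continuous_minus _ R_AbsRing R_NormedModule); now apply continuous_Rmult.
  - apply (@continuous_plus _ R_AbsRing R_NormedModule); now apply continuous_Rmult.
Qed.

Lemma continuous_R_comp (u : R -> R) (v : T -> R) x :
  continuity_pt u (v x) -> continuous v x -> continuous (fun t => u (v t)) x.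
Proof.
  intros Hu Hv; apply continuous_comp; [exact Hv|].
  now apply continuity_pt_filterlim.
Qed.

Lemma continuous_Cinv f x : f x <> 0%C -> contC f x -> contC (fun t => / f t)%C x.
Proof.
  intros Hx Hf.
  pose proof (continuous_Re _ _ Hf); pose proof (continuous_Im _ _ Hf).
  assert (Hn : fst (f x) ^ 2 + snd (f x) ^ 2 <> 0).
  { intros E; apply Hx.
    assert (fst (f x) = 0 /\ snd (f x) = 0) by (split; nra).
    destruct (f x); simpl in *; unfold RtoC; f_equal; tauto. }
  assert (Hd : continuous (fun t => / (fst (f t) ^ 2 + snd (f t) ^ 2)) x).
  { apply (continuous_R_comp Rinv (fun t => fst (f t) ^ 2 + snd (f t) ^ 2)).
    - apply derivable_continuous_pt, derivable_pt_inv; [exact Hn|apply derivable_pt_id].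
    - apply (@continuous_plus _ R_AbsRing R_NormedModule);
        apply (continuous_R_comp (fun r => r ^ 2)); trivial;
        apply derivable_continuous_pt, derivable_pt_pow. }
  apply continuous_C; simpl; unfold Rdiv;
    apply continuous_Rmult; trivial.
  now apply (@continuous_opp _ R_AbsRing R_NormedModule).
Qed.

Lemma continuous_Cdiv f g x :
  g x <> 0%C -> contC f x -> contC g x -> contC (fun t => f t / g t)%C x.
Proof.
  intros; apply continuous_Cmult; trivial; now apply continuous_Cinv.
Qed.

Lemma continuous_Cconst c x : contC (fun _ => c) x.
Proof. apply continuous_const. Qed.

Lemma continuous_Cneq f x c : contC f x -> f x <> c -> locally x (fun t => f t <> c).
Proof.
  intros Hf Hn.
  assert (Hc : 0 < Cmod (f x - c)) by (apply Cmod_gt_0; intros E; apply Hn; rewrite <- (Cplus_0_r c), <- E; ring).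
  apply (filter_imp (fun t => Cmod (f t - f x) < Cmod (f x - c))).
  - intros t Ht E; rewrite E in Ht.
    replace (c - f x)%C with (- (f x - c))%C in Ht by ring.
    rewrite Cmod_opp in Ht; lra.
  - now apply continuous_C_eps.
Qed.
End ContinuousC.

(** * The exponential and the principal logarithm *)

Definition Cexp (z : C) : C := (exp (fst z) * cos (snd z), exp (fst z) * sin (snd z)).

Lemma Cexp_plus (z w : C) : Cexp (z + w) = (Cexp z * Cexp w)%C.
Proof.
  unfold Cexp, Cplus, Cmult; simpl; rewrite exp_plus, cos_plus, sin_plus.
  f_equal; ring.
Qed.

Lemma Cexp_0 : Cexp 0 = 1%C.
Proof.
  unfold Cexp, RtoC; simpl; rewrite exp_0, cos_0, sin_0; f_equal; ring.
Qed.

Lemma Cexp_neq_0 (z : C) : Cexp z <> 0%C.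
Proof.
  intros E; apply C1_nz; rewrite <- Cexp_0.
  replace (RtoC 0) with (z + - z)%C at 1 by ring.
  rewrite Cexp_plus, E; ring.
Qed.

Lemma Cexp_opp (z : C) : Cexp (- z) = (/ Cexp z)%C.
Proof.
  assert (H : (Cexp (- z) * Cexp z)%C = 1%C).
  { rewrite <- Cexp_plus, <- Cexp_0; f_equal; ring. }
  rewrite <- (Cmult_1_l (/ Cexp z)), <- H.
  field; apply Cexp_neq_0.
Qed.

Lemma Cexp_minus (z w : C) : Cexp (z - w) = (Cexp z / Cexp w)%C.
Proof. unfold Cminus; now rewrite Cexp_plus, Cexp_opp. Qed.

Lemma Cmod_Cexp (z : C) : Cmod (Cexp z) = exp (fst z).
Proof.
  unfold Cmod, Cexp; simpl.
  replace (_ + _) with (Rsqr (exp (fst z)) * (Rsqr (sin (snd z)) + Rsqr (cos (snd z)))) by (unfold Rsqr; ring).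
  rewrite sin2_cos2, Rmult_1_r; apply sqrt_Rsqr; left; apply exp_pos.
Qed.

Lemma Cexp_period (z : C) : Cexp (z + (0, 2 * PI)) = Cexp z.
Proof.
  rewrite Cexp_plus.
  replace (Cexp (0, 2 * PI)) with (RtoC 1); [ring|].
  unfold Cexp; simpl; rewrite exp_0, cos_2PI, sin_2PI; unfold RtoC; f_equal; ring.
Qed.

Lemma continuous_Cexp {T : UniformSpace} (f : T -> C) (x : T) :
  contC f x -> contC (fun t => Cexp (f t)) x.
Proof.
  intros Hf; pose proof (continuous_Re _ _ Hf); pose proof (continuous_Im _ _ Hf).
  apply continuous_C; simpl; apply continuous_Rmult;
    (apply continuous_R_comp; [|assumption]).
  - apply derivable_continuous_pt, derivable_pt_exp.
  - apply continuity_cos.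
  - apply derivable_continuous_pt, derivable_pt_exp.
  - apply continuity_sin.
Qed.

(* Principal logarithm, meaningful on the right half-plane only. *)
Definition Clog (z : C) : C := (ln (Cmod z), atan (snd z / fst z)).

Lemma Cexp_Clog (z : C) : 0 < fst z -> Cexp (Clog z) = z.
Proof.
  intros Hz.
  assert (Hm : 0 < Cmod z).
  { eapply Rlt_le_trans; [|apply abs_fst_le_Cmod]; apply Rabs_pos_lt; lra. }
  assert (E : Cmod z = fst z * sqrt (1 + (snd z / fst z)²)).
  { transitivity (sqrt ((fst z)² * (1 + (snd z / fst z)²))).
    - unfold Cmod; f_equal; unfold Rsqr; field; lra.
    - rewrite sqrt_mult_alt by apply Rle_0_sqr.
      rewrite sqrt_Rsqr by lra; reflexivity. }
  assert (Hs : 0 < sqrt (1 + (snd z / fst z)²)).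
  { apply sqrt_lt_R0; pose proof (Rle_0_sqr (snd z / fst z)); lra. }
  unfold Cexp, Clog; simpl; rewrite exp_ln by assumption.
  rewrite cos_atan, sin_atan, E.
  destruct z as [x y]; simpl in *; f_equal; field; lra.
Qed.

Lemma continuous_Clog {T : UniformSpace} (f : T -> C) (x : T) :
  0 < fst (f x) -> contC f x -> contC (fun t => Clog (f t)) x.
Proof.
  intros Hx Hf; pose proof (continuous_Re _ _ Hf); pose proof (continuous_Im _ _ Hf).
  apply continuous_C; simpl.
  - apply (continuous_R_comp ln (fun t => Cmod (f t))).
    + apply derivable_continuous_pt; eexists; apply derivable_pt_lim_ln.
      eapply Rlt_le_trans; [|apply abs_fst_le_Cmod]; apply Rabs_pos_lt; lra.
    + apply (continuous_comp f Cmod); [exact Hf|].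
      exact (filterlim_norm (K := C_AbsRing) (V := C_NormedModule) (f x)).
  - apply (continuous_R_comp atan (fun t => snd (f t) / fst (f t))).
    + apply derivable_continuous_pt, derivable_pt_atan.
    + apply continuous_Rmult; [assumption|].
      apply (continuous_R_comp Rinv (fun t => fst (f t))); [|assumption].
      apply derivable_continuous_pt, derivable_pt_inv; [simpl; lra|apply derivable_pt_id].
Qed.

(** Dividing by one of 1, i, -1, -i, each an explicit exponential, moves any non-zero [z] into the
    right half-plane, where [Clog] inverts [Cexp]. *)
Lemma Cexp_surj (z : C) : z <> 0%C -> exists w, Cexp w = z.
Proof.
  intros Hz.
  assert (Hr : forall k t : C, Cexp t = k -> 0 < fst (z / k)%C -> exists w, Cexp w = z).
  { intros k t Hk Hp; exists (Clog (z / k) + t)%C.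
    rewrite Cexp_plus, Cexp_Clog, Hk by assumption.
    field; rewrite <- Hk; apply Cexp_neq_0. }
  assert (Ei : Cexp (0, PI / 2) = (0, 1)) by
    (unfold Cexp; simpl; rewrite exp_0, cos_PI2, sin_PI2; f_equal; ring).
  assert (Em : Cexp (0, - (PI / 2)) = (0, -1)) by
    (unfold Cexp; simpl; rewrite exp_0, cos_neg, sin_neg, cos_PI2, sin_PI2; f_equal; ring).
  assert (En : Cexp (0, PI) = (-1, 0)) by
    (unfold Cexp; simpl; rewrite exp_0, cos_PI, sin_PI; f_equal; ring).
  destruct (Rtotal_order (fst z) 0) as [H|[H|H]].
  - apply (Hr _ _ En); simpl; lra.
  - destruct (Rtotal_order (snd z) 0) as [K|[K|K]].
    + apply (Hr _ _ Em); simpl; rewrite H; lra.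
    + destruct Hz; destruct z; simpl in *; now subst.
    + apply (Hr _ _ Ei); simpl; rewrite H; lra.
  - apply (Hr _ _ Cexp_0); simpl; lra.
Qed.

(** * Continuous logarithms *)

(** If [u] ended above its start, the intermediate value theorem would produce an increment [s] of
    at most 1. As 1 < pi, the sine of [s] is positive. *)
Lemma sin_zero_le (u : R -> R) :
  (forall t, 0 <= t <= 1 -> continuity_pt u t) ->
  (forall t, 0 <= t <= 1 -> sin (u t - u 0) = 0) -> u 1 <= u 0.
Proof.
  intros Hc Hs; apply Rnot_lt_le; intros Hlt.
  set (s := Rmin (u 1 - u 0) 1).
  assert (H0 : 0 < s) by (apply Rmin_pos; lra).
  assert (H1 : s <= 1) by apply Rmin_r.
  assert (H2 : s <= u 1 - u 0) by apply Rmin_l.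
  destruct (f_interv_is_interv u 0 1 (u 0 + s)) as (t & Ht & Et); trivial; try lra.
  pose proof (sin_gt_0 s H0 ltac:(pose proof PI_4; pose proof PI2_1; lra)) as Hp.
  specialize (Hs t Ht); rewrite Et in Hs.
  replace (u 0 + s - u 0) with s in Hs by ring; lra.
Qed.

(** The fibres of exp are discrete: the modulus fixes the real part, and the sine keeps the
    imaginary part from moving. Applied to a difference of two logarithms of one function, this is
    uniqueness of logarithms along a path. *)
Lemma Cexp_path_const (d : R -> C) :
  (forall t, 0 <= t <= 1 -> contC d t) ->
  (forall t, 0 <= t <= 1 -> Cexp (d t) = Cexp (d 0)) -> d 1 = d 0.
Proof.
  intros Hc He.
  assert (Hs : forall t, 0 <= t <= 1 -> continuity_pt (fun t => snd (d t)) t).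
  { intros t Ht; apply continuity_pt_filterlim; exact (continuous_Im _ _ (Hc t Ht)). }
  assert (Hsin : forall t, 0 <= t <= 1 -> sin (snd (d t) - snd (d 0)) = 0).
  { intros t Ht.
    assert (E : Cexp (d t - d 0) = 1%C).
    { rewrite Cexp_minus, He by trivial; field; apply Cexp_neq_0. }
    apply (f_equal snd) in E; simpl in E.
    apply Rmult_integral in E; destruct E as [E|E]; [|exact E].
    pose proof (exp_pos (fst (d t) + - fst (d 0))); lra. }
  assert (E1 : fst (d 1) = fst (d 0)).
  { apply exp_inv; rewrite <- !Cmod_Cexp, He by lra; reflexivity. }
  assert (E2 : snd (d 1) = snd (d 0)).
  { apply Rle_antisym.
    - exact (sin_zero_le _ Hs Hsin).
    - apply Ropp_le_cancel, (sin_zero_le (fun t => - snd (d t))).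
      + intros t Ht; apply (continuity_pt_opp (fun t => snd (d t))); auto.
      + intros t Ht.
        replace (_ - _) with (- (snd (d t) - snd (d 0))) by ring.
        rewrite sin_neg, Hsin by trivial; ring. }
  rewrite (surjective_pairing (d 1)), (surjective_pairing (d 0)); congruence.
Qed.

(** The quotient lies in the open unit disc about 1, hence in the domain of [Clog]. *)
Lemma Re_div_pos (a b : C) : Cmod (a - b) < Cmod b -> 0 < fst (a / b)%C.
Proof.
  intros H.
  assert (Hm : 0 < Cmod b) by (pose proof (Cmod_ge_0 (a - b)); lra).
  assert (Hb : b <> 0%C) by (intros ->; rewrite Cmod_0 in Hm; lra).
  replace (a / b)%C with (1 + (a - b) / b)%C by (field; trivial).
  assert (K : Cmod ((a - b) / b) < 1).
  { rewrite Cmod_div by trivial; apply Rlt_div_l; lra. }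
  pose proof (abs_fst_le_Cmod ((a - b) / b)) as L.
  pose proof (Rle_abs (- fst ((a - b) / b)%C)) as L'; rewrite Rabs_Ropp in L'.
  change (0 < 1 + fst ((a - b) / b)%C); lra.
Qed.

(** A Lebesgue number argument on the square. If both values are within a third of |phi(u, v)| from
    phi(u, v), they differ by less than two thirds of it, while |phi q| exceeds two thirds of it. *)
Lemma uniform_ratio (phi : C -> C) (M : R) :
  (forall z, contC phi z) -> (forall z, phi z <> 0%C) ->
  exists d, 0 < d /\ forall p q : C,
    Rabs (fst p) <= M -> Rabs (snd p) <= M ->
    Rabs (fst p - fst q) < d -> Rabs (snd p - snd q) < d ->
    Cmod (phi p - phi q) < Cmod (phi q).
Proof.
  intros Hc Hn.
  assert (Hd : forall u v : R, exists r : posreal, forall p : C,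
    Rabs (fst p - u) < 2 * r -> Rabs (snd p - v) < 2 * r ->
    Cmod (phi p - phi (u, v)) < Cmod (phi (u, v)) / 3).
  { intros u v.
    pose proof (proj1 (Cmod_gt_0 _) (Hn (u, v))) as Hp.
    destruct (proj1 (continuous_C_eps phi (u, v)) (Hc _) (Cmod (phi (u, v)) / 3) ltac:(lra)) as [r Hr].
    (* The radius is halved so that [q], which is close to [p] but possibly outside the square,
       still falls in the neighbourhood of (u, v) that covers [p]. *)
    exists (mkposreal (r / 2) ltac:(pose proof (cond_pos r); lra)); simpl.
    intros p H1 H2; apply Hr; split;
      [change (Rabs (fst p - u) < r)|change (Rabs (snd p - v) < r)]; lra. }
  set (delta := fun u v => proj1_sig (constructive_indefinite_description _ (Hd u v))).
  destruct (compactness_value_2d (- M) M (- M) M delta) as [d H].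
  exists d; split; [apply cond_pos|].
  intros p q P1 P2 Q1 Q2.
  apply Rabs_le_between in P1; apply Rabs_le_between in P2.
  specialize (H (fst p) (snd p) P1 P2); apply NNPP in H.
  destruct H as (u & v & _ & _ & H1 & H2 & H3).
  unfold delta in *; destruct (constructive_indefinite_description _ (Hd u v)) as [r Hr]; simpl in *.
  pose proof (cond_pos r) as Hr0; pose proof (Hr p ltac:(lra) ltac:(lra)) as Kp.
  assert (Kq : Cmod (phi q - phi (u, v)) < Cmod (phi (u, v)) / 3).
  { apply Hr.
    - replace (fst q - u) with ((fst p - u) - (fst p - fst q)) by ring.
      eapply Rle_lt_trans; [apply Rabs_triang|]; rewrite Rabs_Ropp; lra.
    - replace (snd q - v) with ((snd p - v) - (snd p - snd q)) by ring.
      eapply Rle_lt_trans; [apply Rabs_triang|]; rewrite Rabs_Ropp; lra. }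
  assert (K1 : Cmod (phi p - phi q) <= Cmod (phi p - phi (u, v)) + Cmod (phi q - phi (u, v))).
  { rewrite <- (Cmod_opp (phi q - phi (u, v))).
    eapply Rle_trans; [|apply Cmod_triangle]; apply Req_le; f_equal; ring. }
  assert (K2 : Cmod (phi (u, v)) <= Cmod (phi q) + Cmod (phi q - phi (u, v))).
  { rewrite <- (Cmod_opp (phi q - phi (u, v))).
    eapply Rle_trans; [|apply Cmod_triangle]; apply Req_le; f_equal; ring. }
  lra.
Qed.

Lemma Clog_1 : Clog 1 = 0%C.
Proof.
  unfold Clog; rewrite Cmod_1, ln_1; simpl.
  replace (0 / 1) with 0 by field; now rewrite atan_0.
Qed.

(* The logarithm of [phi] along the ray through [z] is accumulated from principal
   logarithms of ratios of consecutive values, which are close to [1] when the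
   step is small; no path lifting is needed. *)
Lemma box_log (phi : C -> C) (c : C) (M : R) :
  0 < M -> (forall z, contC phi z) -> (forall z, phi z <> 0%C) -> Cexp c = phi 0%C ->
  exists psi : C -> C, psi 0%C = c /\ forall z : C,
    Rabs (fst z) < M -> Rabs (snd z) < M -> Cexp (psi z) = phi z /\ contC psi z.
Proof.
  intros HM Hc Hn H0.
  destruct (uniform_ratio phi M Hc Hn) as (d & Hd & Hu).
  assert (HN : exists N : nat, 0 < INR N /\ M / INR N < d).
  { destruct (archimed_cor1 (d / M)) as (N & HN & HN0).
    - now apply Rdiv_lt_0_compat.
    - assert (0 < INR N) by now apply lt_0_INR.
      exists N; split; [trivial|].
      apply (Rmult_lt_reg_r (/ M)); [now apply Rinv_0_lt_compat|].
      replace (M / INR N * / M) with (/ INR N) by (field; lra); exact HN. }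
  destruct HN as (N & HN0 & HN).
  assert (Hsc : forall k z, contC (fun z : C => phi (RtoC k * z)%C) z).
  { intros k z; apply (continuous_comp (V := C_UniformSpace) (fun z : C => (RtoC k * z)%C) phi); [|apply Hc].
    apply continuous_Cmult; [apply continuous_Cconst|apply continuous_id]. }
  (* After [n] steps the logarithm is known at the fraction n/N of the way from 0 to [z]. *)
  assert (step : forall n : nat, INR n <= INR N ->
    exists psi : C -> C, psi 0%C = c /\ forall z : C,
    Rabs (fst z) < M -> Rabs (snd z) < M ->
    Cexp (psi z) = phi (RtoC (INR n / INR N) * z)%C /\ contC psi z).
  { induction n as [|n IH]; intros Hle.
    - exists (fun _ => c); split; [trivial|]; intros z _ _; split; [|apply continuous_Cconst].
      rewrite H0; f_equal; simpl.
      replace (0 / INR N) with 0 by (field; lra); ring.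
    - rewrite S_INR in Hle; destruct IH as (psi & P0 & P); [lra|].
      exists (fun z : C => psi z + Clog (phi (RtoC (INR (S n) / INR N) * z) / phi (RtoC (INR n / INR N) * z)))%C; split.
      { rewrite P0, !Cmult_0_r.
        replace (phi 0 / phi 0)%C with (RtoC 1) by (field; apply Hn).
        rewrite Clog_1; ring. }
      intros z Z1 Z2; destruct (P z Z1 Z2) as [P1 P2].
      (* The farther point plays [p] in [Hu] and must stay in the square, which is where
         [INR n + 1 <= INR N] enters. Consecutive points differ by [z / N], coordinatewise below
         [d]. *)
      assert (Hpos : 0 < fst (phi (RtoC (INR (S n) / INR N) * z) / phi (RtoC (INR n / INR N) * z))%C).
      { apply Re_div_pos, Hu.
        - unfold Cmult, RtoC; cbn [fst snd]; rewrite S_INR, Rmult_0_l, Rminus_0_r, Rabs_mult, Rabs_pos_eq.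
          + assert ((INR n + 1) / INR N <= 1) by (apply Rle_div_l; lra).
            pose proof (Rabs_pos (fst z)); nra.
          + apply Rle_div_r; [lra|]; pose proof (pos_INR n); lra.
        - unfold Cmult, RtoC; cbn [fst snd]; rewrite S_INR, Rmult_0_l, Rplus_0_r, Rabs_mult, Rabs_pos_eq.
          + assert ((INR n + 1) / INR N <= 1) by (apply Rle_div_l; lra).
            pose proof (Rabs_pos (snd z)); nra.
          + apply Rle_div_r; [lra|]; pose proof (pos_INR n); lra.
        - unfold Cmult, RtoC; cbn [fst snd]; rewrite S_INR.
          replace (_ - _) with (fst z * / INR N) by (field; lra).
          rewrite Rabs_mult, (Rabs_pos_eq (/ _)) by (left; now apply Rinv_0_lt_compat).
          assert (0 < / INR N) by now apply Rinv_0_lt_compat.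
          unfold Rdiv in HN; nra.
        - unfold Cmult, RtoC; cbn [fst snd]; rewrite S_INR.
          replace (_ - _) with (snd z * / INR N) by (field; lra).
          rewrite Rabs_mult, (Rabs_pos_eq (/ _)) by (left; now apply Rinv_0_lt_compat).
          assert (0 < / INR N) by now apply Rinv_0_lt_compat.
          unfold Rdiv in HN; nra. }
      split.
      + rewrite Cexp_plus, P1, Cexp_Clog by exact Hpos; field; apply Hn.
      + apply continuous_Cplus; [exact P2|].
        apply continuous_Clog; [exact Hpos|].
        apply continuous_Cdiv; [apply Hn|apply Hsc|apply Hsc]. }
  destruct (step N (Rle_refl _)) as (psi & P0 & P).
  exists psi; split; [trivial|]; intros z Z1 Z2.
  destruct (P z Z1 Z2) as [P1 P2]; split; [|trivial].
  rewrite P1; f_equal; replace (INR N / INR N) with 1 by (field; lra); ring.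
Qed.

Lemma continuous_scale (z : C) (t : R) : contC (fun t : R => (RtoC t * z)%C) t.
Proof.
  apply continuous_Cmult; [|apply continuous_Cconst].
  apply continuous_C; simpl; [apply continuous_id|apply continuous_const].
Qed.

(** Logarithms on squares of all sizes, normalised to the same value at 0, agree wherever both are
    defined: along the ray to [z] their difference has constant exponential. They therefore glue. *)
Lemma continuous_log (phi : C -> C) :
  (forall z, contC phi z) -> (forall z, phi z <> 0%C) ->
  exists psi : C -> C, (forall z, contC psi z) /\ forall z, Cexp (psi z) = phi z.
Proof.
  intros Hc Hn.
  destruct (Cexp_surj (phi 0%C) (Hn _)) as [c H0].
  set (P := fun (M : posreal) (psi : C -> C) => psi 0%C = c /\ forall z : C,
    Rabs (fst z) < M -> Rabs (snd z) < M -> Cexp (psi z) = phi z /\ contC psi z).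
  assert (HP : forall M : posreal, exists psi, P M psi)
    by (intros M; apply box_log; trivial; apply cond_pos).
  destruct (choice P HP) as [F HF].
  assert (HB : forall (M : posreal) (z : C), Cmod z < M ->
    Cexp (F M z) = phi z /\ contC (F M) z).
  { intros M z Hz; apply (HF M).
    - pose proof (abs_fst_le_Cmod z); lra.
    - pose proof (abs_snd_le_Cmod z); lra. }
  assert (agree : forall (M M' : posreal) (z : C), Cmod z < M -> Cmod z < M' -> F M z = F M' z).
  { intros M M' z HM HM'.
    assert (Ht : forall t, 0 <= t <= 1 -> Cmod (RtoC t * z) <= Cmod z).
    { intros t Ht; rewrite Cmod_mult, Cmod_R, Rabs_pos_eq by lra.
      pose proof (Cmod_ge_0 z); nra. }
    assert (E : (F M (RtoC 1 * z) - F M' (RtoC 1 * z) = F M (RtoC 0 * z) - F M' (RtoC 0 * z))%C).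
    { apply (Cexp_path_const (fun t => F M (RtoC t * z) - F M' (RtoC t * z))%C).
      - intros t T; specialize (Ht t T); apply continuous_Cminus.
        + apply (continuous_comp (V := C_UniformSpace) (fun t => RtoC t * z)%C (F M)).
          * apply continuous_scale.
          * apply HB; lra.
        + apply (continuous_comp (V := C_UniformSpace) (fun t => RtoC t * z)%C (F M')).
          * apply continuous_scale.
          * apply HB; lra.
      - intros t T; pose proof (Ht t T) as T1; pose proof (Ht 0 ltac:(lra)) as T0.
        rewrite !Cexp_minus, !(fun M z H => proj1 (HB M z H)) by lra.
        field; split; apply Hn. }
    rewrite !Cmult_1_l, !Cmult_0_l in E.
    rewrite (proj1 (HF M)), (proj1 (HF M')) in E.
    replace (F M z) with (F M z - F M' z + F M' z)%C by ring; rewrite E; ring. }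
  assert (pos : forall z : C, 0 < Cmod z + 1) by (intros z; pose proof (Cmod_ge_0 z); lra).
  exists (fun z => F (mkposreal _ (pos z)) z); split.
  - intros z.
    (* The size used at [y] varies with [y]; the single size |z| + 2 serves every [y] within
       distance 1 of [z]. *)
    assert (pz : 0 < Cmod z + 2) by (specialize (pos z); lra).
    apply (continuous_ext_loc _ (F (mkposreal _ pz))).
    + apply locally_Cmod; exists 1; split; [lra|]; intros y Hy.
      apply agree; simpl; [|lra].
      pose proof (Cmod_triangle (y - z) z) as T.
      replace (y - z + z)%C with y in T by ring; lra.
    + apply HB; simpl; lra.
  - intros z; apply HB; simpl; lra.
Qed.

(** * Complex differentiability *)

(* Carathéodory's form of complex differentiability: composition and inversion
   reduce to continuity of the slope function [s]. *)
Definition is_C_derivative (f : C -> C) (z l : C) : Prop :=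
  exists s : C -> C,
    contC s z /\ s z = l /\ forall y, f y = (f z + s y * (y - z))%C.

Lemma Cmod_minus_sym (x y : C) : Cmod (x - y) = Cmod (y - x).
Proof. rewrite <- Cmod_opp; f_equal; ring. Qed.

Lemma Cmod_minus_gt_0 (x y : C) : x <> y -> 0 < Cmod (x - y).
Proof.
  intros H; apply Cmod_gt_0; intros E; apply H.
  rewrite <- (Cplus_0_r y), <- E; ring.
Qed.

Lemma Cminus_neq_0 (x y : C) : x <> y -> (x - y)%C <> 0%C.
Proof. intros H; apply Cmod_gt_0; now apply Cmod_minus_gt_0. Qed.

Lemma is_C_derivative_intro (f : C -> C) (z l : C) :
  (forall e, 0 < e -> locally (T := C_UniformSpace) z
    (fun y => Cmod (f y - f z - l * (y - z)) <= e * Cmod (y - z))) ->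
  is_C_derivative f z l.
Proof.
  intros H.
  exists (fun y => if excluded_middle_informative (y = z) then l else ((f y - f z) / (y - z))%C).
  assert (Ez : (if excluded_middle_informative (z = z) then l else ((f z - f z) / (z - z))%C) = l)
    by (destruct excluded_middle_informative; tauto).
  split; [|split; [exact Ez|]].
  - apply continuous_C_eps; intros e He; rewrite Ez.
    (* Halving [e] turns the non-strict hypothesis into the strict bound of continuity. *)
    eapply filter_imp; [|apply (H (e / 2)); lra].
    intros y Hy; change C in y; cbv beta in Hy; destruct (excluded_middle_informative (y = z)) as [E|E].
    + replace (l - l)%C with (RtoC 0) by ring; now rewrite Cmod_0.
    + replace ((f y - f z) / (y - z) - l)%C with ((f y - f z - l * (y - z)) / (y - z))%C
        by (field; now apply Cminus_neq_0).
      pose proof (Cmod_minus_gt_0 _ _ E).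
      rewrite Cmod_div by now apply Cminus_neq_0.
      apply Rlt_div_l; [trivial|]; nra.
  - clear Ez; intros y; destruct excluded_middle_informative as [->|E]; [ring|].
    field; now apply Cminus_neq_0.
Qed.

Lemma is_C_derivative_eps (f : C -> C) (z l : C) : is_C_derivative f z l ->
  forall e, 0 < e -> exists d, 0 < d /\ forall y, Cmod (y - z) < d ->
    Cmod (f y - f z - l * (y - z)) <= e * Cmod (y - z).
Proof.
  intros (s & Hs & <- & E) e He; apply locally_Cmod.
  eapply filter_imp; [|apply (proj1 (continuous_C_eps s z) Hs e He)].
  intros y Hy; rewrite (E y).
  replace (f z + s y * (y - z) - f z - s z * (y - z))%C with ((s y - s z) * (y - z))%C by ring.
  rewrite Cmod_mult; pose proof (Cmod_ge_0 (y - z)); nra.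
Qed.

Lemma is_derive_is_C_derivative (f : C -> C) (z l : C) :
  is_derive (K := C_AbsRing) (V := C_NormedModule) f z l -> is_C_derivative f z l.
Proof.
  intros [_ H]; apply is_C_derivative_intro; intros e He.
  specialize (H z (fun P HP => HP) (mkposreal e He)); simpl in H.
  apply locally_C in H.
  eapply filter_imp; [|exact H].
  intros y Hy; rewrite Cmult_comm; exact Hy.
Qed.

Lemma is_C_derivative_continuous (f : C -> C) (z l : C) :
  is_C_derivative f z l -> contC f z.
Proof.
  intros (s & Hs & _ & E).
  apply (continuous_ext (fun y => f z + s y * (y - z))%C); [intros y; symmetry; apply E|].
  apply continuous_Cplus; [apply continuous_Cconst|].
  apply continuous_Cmult; [trivial|].
  apply continuous_Cminus; [apply continuous_id|apply continuous_Cconst].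
Qed.

Definition holomorphic (f : C -> C) : Prop := forall z, exists l, is_C_derivative f z l.

Lemma holomorphic_continuous (f : C -> C) : holomorphic f -> forall z, contC f z.
Proof. intros H z; destruct (H z) as [l Hl]; now apply is_C_derivative_continuous in Hl. Qed.

Lemma is_C_derivative_comp (f g : C -> C) (z l m : C) :
  is_C_derivative g z m -> is_C_derivative f (g z) l ->
  is_C_derivative (fun y => f (g y)) z (l * m)%C.
Proof.
  intros Hg (s & Hs & Es & F); pose proof (is_C_derivative_continuous _ _ _ Hg) as Cg.
  destruct Hg as (t & Ht & Et & G).
  exists (fun y => s (g y) * t y)%C; split; [|split].
  - apply continuous_Cmult; [|trivial].
    now apply (continuous_comp (V := C_UniformSpace) g s).
  - now rewrite Es, Et.
  - intros y; rewrite (F (g y)).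
    replace (g y - g z)%C with (t y * (y - z))%C by (rewrite (G y); ring); ring.
Qed.

Lemma is_C_derivative_add_const (f : C -> C) (c z l : C) :
  is_C_derivative f z l -> is_C_derivative (fun y => f y + c)%C z l.
Proof.
  intros (s & Hs & E & F); exists s; repeat split; trivial.
  intros y; rewrite (F y) at 1; ring.
Qed.

Lemma is_C_derivative_opp (z : C) : is_C_derivative Copp z (-1)%C.
Proof.
  exists (fun _ => (-1)%C); split; [apply continuous_Cconst|split; [trivial|]].
  intros y; ring.
Qed.

Lemma is_C_derivative_mult (f g : C -> C) (z l m : C) :
  is_C_derivative f z l -> is_C_derivative g z m ->
  is_C_derivative (fun y => f y * g y)%C z (l * g z + f z * m)%C.
Proof.
  intros Hf; pose proof (is_C_derivative_continuous _ _ _ Hf) as Cf.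
  destruct Hf as (s & Hs & <- & F); intros (t & Ht & <- & G).
  exists (fun y => s y * g z + f y * t y)%C; split; [|split; [trivial|]].
  - apply continuous_Cplus; apply continuous_Cmult; trivial; apply continuous_Cconst.
  - intros y; rewrite (G y), (F y); ring.
Qed.

Lemma is_C_derivative_inv_comp (f : C -> C) (z l : C) : (forall y, f y <> 0%C) ->
  is_C_derivative f z l -> is_C_derivative (fun y => / f y)%C z (- l / (f z * f z))%C.
Proof.
  intros Hn Hf; pose proof (is_C_derivative_continuous _ _ _ Hf) as Cf.
  destruct Hf as (s & Hs & <- & F).
  exists (fun y => - s y / (f y * f z))%C; split; [|split; [trivial|]].
  - apply continuous_Cdiv; [apply Cmult_neq_0; apply Hn|now apply continuous_Copp|].
    apply continuous_Cmult; [trivial|apply continuous_Cconst].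
  - intros y; rewrite (F y); field; split; [apply Hn|]; rewrite <- F; apply Hn.
Qed.

Lemma real_slope_eps (f : R -> R) (l : R) : derivable_pt_lim f 0 l ->
  forall e, 0 < e -> exists d, 0 < d /\ forall x, Rabs x < d ->
    Rabs (f x - f 0 - l * x) <= e * Rabs x.
Proof.
  intros H e He; destruct (H e He) as [d Hd]; exists d; split; [apply cond_pos|].
  intros x Hx; destruct (Req_dec x 0) as [->|Hx0].
  - replace (f 0 - f 0 - l * 0) with 0 by ring; rewrite Rabs_R0; lra.
  - specialize (Hd x Hx0 Hx); rewrite Rplus_0_l in Hd.
    replace (f x - f 0 - l * x) with (((f x - f 0) / x - l) * x) by (field; trivial).
    rewrite Rabs_mult; pose proof (Rabs_pos x); nra.
Qed.

Lemma is_C_derivative_Cexp_0 : is_C_derivative Cexp 0 1.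
Proof.
  apply is_C_derivative_intro; intros e He; apply locally_Cmod.
  (* Seven error terms of at most [e / 8 * r] arise, three in the real part and four in the
     imaginary part. The bounds 1 and [e / 8] on [r] absorb the products of small quantities. *)
  assert (He8 : 0 < e / 8) by lra.
  destruct (real_slope_eps exp 1 derivable_pt_lim_exp_0 _ He8) as (d1 & D1 & H1).
  destruct (real_slope_eps cos 0 ltac:(pose proof (derivable_pt_lim_cos 0) as K; rewrite sin_0, Ropp_0 in K; exact K) _ He8) as (d2 & D2 & H2).
  destruct (real_slope_eps sin 1 ltac:(pose proof (derivable_pt_lim_sin 0) as K; rewrite cos_0 in K; exact K) _ He8) as (d3 & D3 & H3).
  assert (Hm : 0 < Rmin (Rmin d1 d2) (Rmin d3 (Rmin 1 (e / 8)))) by (repeat apply Rmin_pos; lra).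
  exists (Rmin (Rmin d1 d2) (Rmin d3 (Rmin 1 (e / 8)))); split; [trivial|].
  intros z; replace (z - 0)%C with z by ring; intros Hz.
  apply Rmin_Rgt in Hz; destruct Hz as [Hz1 Hz2].
  apply Rmin_Rgt in Hz1; apply Rmin_Rgt in Hz2; destruct Hz1 as [Z1 Z2]; destruct Hz2 as [Z3 Hz2].
  apply Rmin_Rgt in Hz2; destruct Hz2 as [Z4 Z5].
  pose proof (abs_fst_le_Cmod z) as Ax; pose proof (abs_snd_le_Cmod z) as Ay.
  set (r := Cmod z) in *; destruct z as [x y]; cbn [fst snd] in *.
  specialize (H1 x ltac:(lra)); specialize (H2 y ltac:(lra)); specialize (H3 y ltac:(lra)).
  rewrite exp_0 in H1; rewrite cos_0 in H2; rewrite sin_0 in H3.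
  rewrite Cexp_0.
  eapply Rle_trans; [apply Cmod_le_abs|].
  unfold Cexp, Cminus, Copp, Cplus, Cmult, RtoC; cbn [fst snd].
  replace (exp x * cos y + _ + _) with
    ((exp x - 1 - 1 * x) * cos y + (x + 1) * (cos y - 1 - 0 * y)) by ring.
  replace (exp x * sin y + _ + _) with
    ((exp x - 1 - 1 * x) * sin y + x * sin y + (sin y - 0 - 1 * y)) by ring.
  assert (Sy : Rabs (sin y) <= 1) by (apply Rabs_le; pose proof (SIN_bound y); lra).
  assert (Cy : Rabs (cos y) <= 1) by (apply Rabs_le; pose proof (COS_bound y); lra).
  assert (Sr : Rabs (sin y) <= e / 8 * r + r).
  { replace (sin y) with ((sin y - 0 - 1 * y) + y) by ring.
    eapply Rle_trans; [apply Rabs_triang|]; nra. }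
  assert (Rx : Rabs (x + 1) <= 2).
  { eapply Rle_trans; [apply Rabs_triang|]; rewrite Rabs_R1; lra. }
  assert (T1 : Rabs ((exp x - 1 - 1 * x) * cos y + (x + 1) * (cos y - 1 - 0 * y)) <= e / 8 * r + 2 * (e / 8 * r)).
  { eapply Rle_trans; [apply Rabs_triang|]; rewrite !Rabs_mult; apply Rplus_le_compat.
    - rewrite <- (Rmult_1_r (e / 8 * r)); apply Rmult_le_compat; try apply Rabs_pos; nra.
    - apply Rmult_le_compat; try apply Rabs_pos; nra. }
  assert (T2 : Rabs ((exp x - 1 - 1 * x) * sin y + x * sin y + (sin y - 0 - 1 * y)) <= e / 8 * r + r * (e / 8 * r + r) + e / 8 * r).
  { eapply Rle_trans; [apply Rabs_triang|]; apply Rplus_le_compat; [|nra].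
    eapply Rle_trans; [apply Rabs_triang|]; rewrite !Rabs_mult; apply Rplus_le_compat.
    - rewrite <- (Rmult_1_r (e / 8 * r)); apply Rmult_le_compat; try apply Rabs_pos; nra.
    - apply Rmult_le_compat; try apply Rabs_pos; nra. }
  assert (0 <= r) by apply Cmod_ge_0.
  assert (r * r <= e / 8 * r) by nra.
  assert (r * (e / 8 * r) <= e / 8 * r) by nra.
  assert (0 <= e * r) by nra.
  lra.
Qed.

Lemma is_C_derivative_Cexp (z : C) : is_C_derivative Cexp z (Cexp z).
Proof.
  destruct is_C_derivative_Cexp_0 as (s & Hs & Es & F).
  exists (fun y => Cexp z * s (y + - z))%C; split; [|split].
  - apply continuous_Cmult; [apply continuous_Cconst|].
    apply (continuous_comp (V := C_UniformSpace) (fun y : C => y + - z)%C s).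
    + apply continuous_Cplus; [apply continuous_id|apply continuous_Cconst].
    + now replace (z + - z)%C with (RtoC 0) by ring.
  - replace (z + - z)%C with (RtoC 0) by ring; rewrite Es; ring.
  - intros y; replace y with (z + (y + - z))%C at 1 by ring.
    rewrite Cexp_plus, (F (y + - z)%C), Cexp_0; ring.
Qed.

(** The slope of [g] is the slope of [f] divided by that of [Cexp] along [g], which is non-zero at
    [z]. Elsewhere the divisor may vanish, so the quotient is a slope only near [z], and the proof
    goes through the local criterion [is_C_derivative_intro]. *)
Lemma holomorphic_log (f g : C -> C) :
  holomorphic f -> (forall z, contC g z) -> (forall z, Cexp (g z) = f z) -> holomorphic g.
Proof.
  intros Hf Hg E z.
  destruct (Hf z) as (l & s & Hs & <- & F).
  destruct (is_C_derivative_Cexp (g z)) as (t & Ht & Et & G).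
  assert (Htg : contC (fun y => t (g y)) z) by (apply (continuous_comp (V := C_UniformSpace) g t); trivial).
  assert (Hn : t (g z) <> 0%C) by (rewrite Et; apply Cexp_neq_0).
  assert (K : forall y, t (g y) <> 0%C -> (g y - g z)%C = (s y / t (g y) * (y - z))%C).
  { intros y Hy.
    assert (X : (t (g y) * (g y - g z))%C = (s y * (y - z))%C).
    { specialize (F y); rewrite <- !E, (G (g y)) in F.
      replace (t (g y) * (g y - g z))%C with (Cexp (g z) + t (g y) * (g y - g z) - Cexp (g z))%C by ring.
      rewrite F; ring. }
    replace (g y - g z)%C with (t (g y) * (g y - g z) / t (g y))%C by (field; trivial).
    rewrite X; field; trivial. }
  exists (s z / t (g z))%C; apply is_C_derivative_intro; intros e He.
  assert (Hq : contC (fun y => s y / t (g y))%C z) by now apply continuous_Cdiv.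
  eapply filter_imp; [|apply filter_and;
    [exact (continuous_Cneq _ _ _ Htg Hn)|exact (proj1 (continuous_C_eps _ _) Hq e He)]].
  intros y [Hy1 Hy2]; rewrite (K y Hy1).
  replace (_ - _)%C with ((s y / t (g y) - s z / t (g z)) * (y - z))%C by ring.
  rewrite Cmod_mult; pose proof (Cmod_ge_0 (y - z)); nra.
Qed.

(** * Goursat's theorem *)

Definition CInt (f : R -> C) (a b : R) : C := RInt (V := C_R_CompleteNormedModule) f a b.

Lemma norm_Cmod (z : C) : norm (V := C_R_NormedModule) z = Cmod z.
Proof.
  unfold norm; simpl; unfold prod_norm, Cmod, norm; simpl; unfold abs; simpl.
  now rewrite !Rmult_1_r, <- !Rabs_mult, !(Rabs_pos_eq (_ * _)) by apply Rle_0_sqr.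
Qed.

Lemma ex_CInt (f : R -> C) (a b : R) : (forall t, contC f t) -> ex_RInt (V := C_R_NormedModule) f a b.
Proof. intros H; apply (ex_RInt_continuous (V := C_R_CompleteNormedModule)); intros t _; apply H. Qed.

Lemma CInt_near_const (f : R -> C) (a b B : R) (k : C) :
  a <= b -> (forall t, contC f t) ->
  (forall t, a <= t <= b -> Cmod (f t - k) <= B) ->
  Cmod (CInt f a b - RtoC (b - a) * k) <= (b - a) * B.
Proof.
  intros Hab Hc HB.
  unfold CInt; rewrite <- scal_R_Cmult, <- norm_Cmod.
  apply (norm_RInt_le_const (V := C_R_NormedModule) (fun t => minus (f t) k) a b).
  - trivial.
  - intros t Ht; rewrite norm_Cmod; now apply HB.
  - apply (is_RInt_minus (V := C_R_NormedModule)).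
    + apply (RInt_correct (V := C_R_CompleteNormedModule)); now apply ex_CInt.
    + exact (is_RInt_const (V := C_R_NormedModule) a b k).
Qed.

Lemma CInt_plus (f g : R -> C) (a b : R) :
  (forall t, contC f t) -> (forall t, contC g t) ->
  CInt (fun t => f t + g t)%C a b = (CInt f a b + CInt g a b)%C.
Proof. intros Hf Hg; apply (RInt_plus (V := C_R_CompleteNormedModule)); now apply ex_CInt. Qed.

Lemma CInt_Chasles (f : R -> C) (a b c : R) :
  (forall t, contC f t) -> (CInt f a b + CInt f b c)%C = CInt f a c.
Proof. intros Hf; apply (RInt_Chasles (V := C_R_CompleteNormedModule)); now apply ex_CInt. Qed.

Lemma CInt_ext (f g : R -> C) (a b : R) : (forall t, f t = g t) -> CInt f a b = CInt g a b.
Proof. intros H; apply (RInt_ext (V := C_R_CompleteNormedModule)); intros; apply H. Qed.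

(* Opposite sides are paired, so that on affine functions both integrands are constant. *)
Definition rect_int (q : C -> C) (x1 x2 y1 y2 : R) : C :=
  (CInt (fun x => q (x, y1) - q (x, y2)) x1 x2 +
   (0, 1) * CInt (fun y => q (x2, y) - q (x1, y)) y1 y2)%C.

Section Goursat.
Variable q : C -> C.
Hypothesis hq : holomorphic q.

Lemma continuous_row (y t : R) : contC (fun x : R => q (x, y)) t.
Proof.
  apply (continuous_comp (V := C_UniformSpace) (fun x => (x, y) : C) q).
  - apply continuous_C; simpl; [apply continuous_id|apply continuous_const].
  - now apply holomorphic_continuous.
Qed.

Lemma continuous_col (x t : R) : contC (fun y : R => q (x, y)) t.
Proof.
  apply (continuous_comp (V := C_UniformSpace) (fun y => (x, y) : C) q).
  - apply continuous_C; simpl; [apply continuous_const|apply continuous_id].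
  - now apply holomorphic_continuous.
Qed.

Lemma continuous_rows (y1 y2 t : R) : contC (fun x : R => q (x, y1) - q (x, y2))%C t.
Proof. apply continuous_Cminus; apply continuous_row. Qed.

Lemma continuous_cols (x1 x2 t : R) : contC (fun y : R => q (x1, y) - q (x2, y))%C t.
Proof. apply continuous_Cminus; apply continuous_col. Qed.

(** The common edge at [x2] is traversed in both directions and cancels. *)
Lemma rect_int_split_x (x1 x2 x3 y1 y2 : R) :
  rect_int q x1 x3 y1 y2 = (rect_int q x1 x2 y1 y2 + rect_int q x2 x3 y1 y2)%C.
Proof.
  unfold rect_int.
  rewrite <- (CInt_Chasles _ x1 x2 x3) by apply continuous_rows.
  rewrite (CInt_ext (fun y => q (x3, y) - q (x1, y))%C
    (fun y => (q (x3, y) - q (x2, y)) + (q (x2, y) - q (x1, y)))%C) by (intros; ring).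
  rewrite CInt_plus by apply continuous_cols; ring.
Qed.

Lemma rect_int_split_y (x1 x2 y1 y2 y3 : R) :
  rect_int q x1 x2 y1 y3 = (rect_int q x1 x2 y1 y2 + rect_int q x1 x2 y2 y3)%C.
Proof.
  unfold rect_int.
  rewrite <- (CInt_Chasles _ y1 y2 y3) by apply continuous_cols.
  rewrite (CInt_ext (fun x => q (x, y1) - q (x, y3))%C
    (fun x => (q (x, y1) - q (x, y2)) + (q (x, y2) - q (x, y3)))%C) by (intros; ring).
  rewrite CInt_plus by apply continuous_rows; ring.
Qed.

Lemma rect_int_quarter (x y a b c : R) :
  c <= Cmod (rect_int q x (x + a) y (y + b)) ->
  exists x' y', (x' = x \/ x' = x + a / 2) /\ (y' = y \/ y' = y + b / 2) /\
    c / 4 <= Cmod (rect_int q x' (x' + a / 2) y' (y' + b / 2)).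
Proof.
  intros H; apply NNPP; intros Hn.
  assert (K : forall x' y', (x' = x \/ x' = x + a / 2) -> (y' = y \/ y' = y + b / 2) ->
    Cmod (rect_int q x' (x' + a / 2) y' (y' + b / 2)) < c / 4).
  { intros x' y' Hx Hy; apply Rnot_le_lt; intros L; apply Hn; exists x', y'; tauto. }
  rewrite (rect_int_split_x x (x + a / 2) (x + a)), !(rect_int_split_y _ _ y (y + b / 2) (y + b)) in H.
  replace (x + a) with (x + a / 2 + a / 2) in H at 1 2 by field.
  replace (y + b) with (y + b / 2 + b / 2) in H by field.
  pose proof (K x y ltac:(tauto) ltac:(tauto)).
  pose proof (K x (y + b / 2) ltac:(tauto) ltac:(tauto)).
  pose proof (K (x + a / 2) y ltac:(tauto) ltac:(tauto)).
  pose proof (K (x + a / 2) (y + b / 2) ltac:(tauto) ltac:(tauto)).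
  pose proof (Cmod_triangle
    (rect_int q x (x + a / 2) y (y + b / 2) + rect_int q x (x + a / 2) (y + b / 2) (y + b / 2 + b / 2))
    (rect_int q (x + a / 2) (x + a / 2 + a / 2) y (y + b / 2) +
     rect_int q (x + a / 2) (x + a / 2 + a / 2) (y + b / 2) (y + b / 2 + b / 2))).
  pose proof (Cmod_triangle (rect_int q x (x + a / 2) y (y + b / 2))
    (rect_int q x (x + a / 2) (y + b / 2) (y + b / 2 + b / 2))).
  pose proof (Cmod_triangle (rect_int q (x + a / 2) (x + a / 2 + a / 2) y (y + b / 2))
     (rect_int q (x + a / 2) (x + a / 2 + a / 2) (y + b / 2) (y + b / 2 + b / 2))).
  lra.
Qed.

(** For the affine approximation the two integrands are the constants [k1] = -i b l and [k2] = a l,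
    and a k1 + i b k2 = 0. Only the remainder counts, at most [2 * e] on each pair of opposite
    sides. *)
Lemma rect_int_near_affine (x y a b e : R) (p l : C) :
  0 <= a -> 0 <= b -> 0 <= e ->
  (forall s t, x <= s <= x + a -> y <= t <= y + b ->
     Cmod (q (s, t) - q p - l * ((s, t) - p)) <= e) ->
  Cmod (rect_int q x (x + a) y (y + b)) <= (a + b) * (2 * e).
Proof.
  intros Ha Hb He H.
  pose (k1 := (l * (0, (- b)%R))%C); pose (k2 := (l * RtoC a)%C).
  assert (H1 : Cmod (CInt (fun s => q (s, y) - q (s, (y + b)%R))%C x (x + a) - RtoC (x + a - x) * k1) <= (x + a - x) * (2 * e)).
  { apply CInt_near_const; [lra|apply continuous_rows|]; intros s Hs.
    replace (_ - _)%C with ((q (s, y) - q p - l * ((s, y) - p)) - (q (s, (y + b)%R) - q p - l * ((s, (y + b)%R) - p)))%C.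
    - eapply Rle_trans; [apply Cmod_triangle|]; rewrite Cmod_opp.
      pose proof (H s y Hs ltac:(lra)); pose proof (H s (y + b) Hs ltac:(lra)); lra.
    - unfold k1; replace ((0, - b) : C) with ((s, y) - (s, (y + b)%R)%R)%C; [ring|].
      unfold Cminus, Cplus, Copp; simpl; f_equal; ring. }
  assert (H2 : Cmod (CInt (fun t => q ((x + a)%R, t) - q (x, t))%C y (y + b) - RtoC (y + b - y) * k2) <= (y + b - y) * (2 * e)).
  { apply CInt_near_const; [lra|apply continuous_cols|]; intros t Ht.
    replace (_ - _)%C with ((q ((x + a)%R, t) - q p - l * (((x + a)%R, t) - p)) - (q (x, t) - q p - l * ((x, t) - p)))%C.
    - eapply Rle_trans; [apply Cmod_triangle|]; rewrite Cmod_opp.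
      pose proof (H x t ltac:(lra) Ht); pose proof (H (x + a) t ltac:(lra) Ht); lra.
    - unfold k2; replace (RtoC a) with (((x + a)%R, t) - (x, t))%C; [ring|].
      unfold RtoC, Cminus, Cplus, Copp; simpl; f_equal; ring. }
  unfold rect_int.
  replace (_ + _)%C with
    ((CInt (fun s => q (s, y) - q (s, (y + b)%R))%C x (x + a) - RtoC (x + a - x) * k1) +
     (0, 1) * (CInt (fun t => q ((x + a)%R, t) - q (x, t))%C y (y + b) - RtoC (y + b - y) * k2))%C.
  - eapply Rle_trans; [apply Cmod_triangle|]; rewrite Cmod_mult.
    replace (Cmod (0, 1)) with 1; [lra|].
    unfold Cmod; simpl; replace (0 * (0 * 1) + 1 * (1 * 1)) with 1 by ring; now rewrite sqrt_1.
  - assert (Z : (RtoC (x + a - x) * k1 + (0, 1) * (RtoC (y + b - y) * k2))%C = 0%C).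
    { unfold k1, k2; destruct l; unfold RtoC, Cplus, Cmult; simpl; f_equal; ring. }
    symmetry; match goal with |- ?L = _ => transitivity (L - (RtoC (x + a - x) * k1 + (0, 1) * (RtoC (y + b - y) * k2)))%C end;
      [rewrite Z|]; ring.
Qed.

(** Every left end point lies below every right end point, so the supremum of the left ones is in
    all the intervals. *)
Lemma nested_limit (u : nat -> R) (a : R) :
  0 <= a -> (forall n, u n <= u (S n) /\ u (S n) + a / 2 ^ S n <= u n + a / 2 ^ n) ->
  exists p, forall n, u n <= p <= u n + a / 2 ^ n.
Proof.
  intros Ha H.
  assert (H2 : forall n, 0 <= a / 2 ^ n).
  { intros n; apply Rmult_le_pos; [trivial|]; left; apply Rinv_0_lt_compat, pow_lt; lra. }
  assert (mono : forall n m, u n <= u (n + m)%nat /\ u (n + m)%nat + a / 2 ^ (n + m) <= u n + a / 2 ^ n).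
  { intros n; induction m as [|m IH].
    - rewrite Nat.add_0_r; lra.
    - rewrite Nat.add_succ_r; destruct (H (n + m)%nat); lra. }
  assert (cross : forall n m, u n <= u m + a / 2 ^ m).
  { intros n m; destruct (mono n m) as [A1 _]; destruct (mono m n) as [_ B2].
    rewrite (Nat.add_comm m n) in B2; specialize (H2 (n + m)%nat); lra. }
  destruct (completeness (fun r => exists n, r = u n)) as [p [P1 P2]].
  - exists (u 0%nat + a / 2 ^ 0); intros r [n ->]; apply cross.
  - exists (u 0%nat), 0%nat; trivial.
  - exists p; intros n; split.
    + apply P1; now exists n.
    + apply P2; intros r [m ->]; apply cross.
Qed.

(** Repeated quartering keeps an integral of at least c / 4^n, while differentiability at the limit
    point bounds it by 2 e D^2 with D = (a + b) / 2^n. The powers of 4 cancel and [e] can be taken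
    too small for this. *)
Theorem goursat (x y a b : R) : 0 <= a -> 0 <= b -> rect_int q x (x + a) y (y + b) = 0%C.
Proof.
  intros Ha Hb; apply NNPP; intros Hne.
  apply Cmod_gt_0 in Hne; set (c := Cmod _) in Hne.
  set (P := fun n (s : R * R) => c / 4 ^ n <=
    Cmod (rect_int q (fst s) (fst s + a / 2 ^ n) (snd s) (snd s + b / 2 ^ n))).
  (* The condition [P] is placed under the existential so that choice yields a total function to
     iterate. *)
  assert (Hstep : forall ns : nat * (R * R), exists s' : R * R, P (fst ns) (snd ns) ->
    P (S (fst ns)) s' /\
    (fst s' = fst (snd ns) \/ fst s' = fst (snd ns) + a / 2 ^ fst ns / 2) /\
    (snd s' = snd (snd ns) \/ snd s' = snd (snd ns) + b / 2 ^ fst ns / 2)).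
  { intros [n s]; cbn [fst snd].
    destruct (classic (P n s)) as [Hp|Hp]; [|exists s; tauto].
    destruct (rect_int_quarter _ _ _ _ _ Hp) as (x' & y' & X & Y & H').
    exists (x', y'); intros _; split; [|now split].
    unfold P; cbn [fst snd].
    assert (2 ^ n <> 0) by (apply pow_nonzero; lra).
    assert (4 ^ n <> 0) by (apply pow_nonzero; lra).
    replace (a / 2 ^ S n) with (a / 2 ^ n / 2) by (simpl; field; trivial).
    replace (b / 2 ^ S n) with (b / 2 ^ n / 2) by (simpl; field; trivial).
    replace (c / 4 ^ S n) with (c / 4 ^ n / 4) by (simpl; field; trivial).
    exact H'. }
  apply choice in Hstep; destruct Hstep as [F HF].
  set (s := nat_rect (fun _ => (R * R)%type) (x, y) (fun n s => F (n, s))).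
  assert (HP : forall n, P n (s n)).
  { induction n as [|n IH].
    - unfold P; simpl; unfold c; rewrite !Rdiv_1_r; apply Rle_refl.
    - exact (proj1 (HF (n, s n) IH)). }
  assert (Hs : forall n,
    (fst (s (S n)) = fst (s n) \/ fst (s (S n)) = fst (s n) + a / 2 ^ n / 2) /\
    (snd (s (S n)) = snd (s n) \/ snd (s (S n)) = snd (s n) + b / 2 ^ n / 2))
    by (intros n; exact (proj2 (HF (n, s n) (HP n)))).
  assert (half : forall d n, 0 <= d -> 0 <= d / 2 ^ n /\ d / 2 ^ S n = d / 2 ^ n / 2).
  { intros d n Hd; split.
    - apply Rmult_le_pos; [trivial|]; left; apply Rinv_0_lt_compat, pow_lt; lra.
    - simpl; field; apply pow_nonzero; lra. }
  destruct (nested_limit (fun n => fst (s n)) a Ha) as [px Hx].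
  { intros n; destruct (half a n Ha) as [? ->]; destruct (Hs n) as [[-> | ->] _]; lra. }
  destruct (nested_limit (fun n => snd (s n)) b Hb) as [py Hy].
  { intros n; destruct (half b n Hb) as [? ->]; destruct (Hs n) as [_ [-> | ->]]; lra. }
  destruct (hq (px, py)) as [l Hl].
  (* The final inequality c <= 2 e (a + b)^2 then gives c <= c / 2. The added 1 keeps the
     denominator non-zero for a degenerate rectangle. *)
  set (e := c / (4 * (a + b + 1) ^ 2)).
  assert (He : 0 < e) by (apply Rdiv_lt_0_compat; [trivial|nra]).
  destruct (is_C_derivative_eps _ _ _ Hl e He) as (d & Hd & Hq).
  assert (HN : exists n, (a + b + 1) / 2 ^ n < d).
  { destruct (Pow_x_infinity 2 ltac:(rewrite Rabs_pos_eq; lra) ((a + b + 1) / d + 1)) as [n Hn].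
    exists n; specialize (Hn n (le_n _)).
    assert (0 < 2 ^ n) by (apply pow_lt; lra).
    rewrite Rabs_pos_eq in Hn by lra.
    apply Rlt_div_l; [trivial|]; rewrite Rmult_comm; apply Rlt_div_l; [trivial|]; lra. }
  destruct HN as [n Hn].
  specialize (HP n); unfold P in HP; specialize (Hx n); specialize (Hy n); cbv beta in Hx, Hy.
  destruct (half a n Ha) as [An _]; destruct (half b n Hb) as [Bn _].
  destruct (half 1 n ltac:(lra)) as [On _].
  assert (Edist : (a + b + 1) / 2 ^ n = a / 2 ^ n + b / 2 ^ n + 1 / 2 ^ n)
    by (field; apply pow_nonzero; lra).
  set (D := a / 2 ^ n + b / 2 ^ n) in *.
  assert (HJ : Cmod (rect_int q (fst (s n)) (fst (s n) + a / 2 ^ n) (snd (s n)) (snd (s n) + b / 2 ^ n))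
    <= D * (2 * (e * D))).
  { apply (rect_int_near_affine _ _ _ _ (e * D) (px, py) l); trivial.
    - unfold D; nra.
    - intros u v Hu Hv.
      assert (Hdist : Cmod ((u, v) - (px, py)) <= D).
      { eapply Rle_trans; [apply Cmod_le_abs|]; unfold D; simpl; apply Rplus_le_compat;
          apply Rabs_le; lra. }
      eapply Rle_trans; [apply Hq; lra|]; apply Rmult_le_compat_l; lra. }
  assert (E4 : 4 ^ n = 2 ^ n * 2 ^ n) by (rewrite <- Rpow_mult_distr; f_equal; ring).
  assert (H2n : 0 < 2 ^ n) by (apply pow_lt; lra).
  assert (HD : D * 2 ^ n = a + b) by (unfold D; field; lra).
  assert (Hc : c / 4 ^ n * 4 ^ n <= D * (2 * (e * D)) * 4 ^ n)
    by (apply Rmult_le_compat_r; [left; apply pow_lt|]; lra).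
  replace (c / 4 ^ n * 4 ^ n) with c in Hc by (field; apply pow_nonzero; lra).
  replace (D * (2 * (e * D)) * 4 ^ n) with (2 * e * ((D * 2 ^ n) * (D * 2 ^ n))) in Hc by (rewrite E4; ring).
  rewrite HD in Hc.
  assert (Ec : c = e * (4 * (a + b + 1) ^ 2)) by (unfold e; field; nra).
  assert ((a + b) * (a + b) <= (a + b + 1) ^ 2) by nra.
  assert (e * ((a + b) * (a + b)) <= e * (a + b + 1) ^ 2) by (apply Rmult_le_compat_l; lra).
  nra.
Qed.
End Goursat.

(** By periodicity the horizontal sides cancel in Goursat's theorem, so the two vertical sides must
    agree. *)
Lemma periodic_integral_const (q : C -> C) (x1 x2 P : R) :
  holomorphic q -> (forall x, q (x, 0) = q (x, P)) -> 0 <= P -> x1 <= x2 ->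
  CInt (fun y => q (x1, y)) 0 P = CInt (fun y => q (x2, y)) 0 P.
Proof.
  intros hq Hper HP Hx.
  pose proof (goursat q hq x1 0 (x2 - x1) P ltac:(lra) HP) as G.
  unfold rect_int in G.
  replace (x1 + (x2 - x1)) with x2 in G by ring; rewrite Rplus_0_l in G.
  assert (Z : CInt (fun x => q (x, 0) - q (x, P))%C x1 x2 = RtoC 0).
  { rewrite (CInt_ext _ (fun _ => RtoC 0)) by (intros t; rewrite Hper; ring).
    unfold CInt; rewrite (RInt_const (V := C_R_CompleteNormedModule)), scal_R_Cmult; apply Cmult_0_r. }
  rewrite Z, Cplus_0_l in G.
  assert (S : CInt (fun y => q (x2, y)) 0 P =
    (CInt (fun y => q (x2, y) - q (x1, y))%C 0 P + CInt (fun y => q (x1, y)) 0 P)%C).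
  { rewrite <- CInt_plus.
    - apply CInt_ext; intros; ring.
    - intros t; now apply continuous_cols.
    - intros t; now apply continuous_col. }
  rewrite S.
  replace (CInt (fun y => q (x2, y) - q (x1, y))%C 0 P) with
    ((0, (-1)%R) * ((0, 1) * CInt (fun y => q (x2, y) - q (x1, y))%C 0 P))%C.
  - rewrite G; ring.
  - rewrite Cmult_assoc; replace ((0, (-1)%R) * (0, 1))%C with (RtoC 1); [ring|].
    unfold RtoC, Cmult; simpl; f_equal; ring.
Qed.

(** * Liouville's theorem *)

(** Restriction to the segment from 0 to [z] reduces this to one real variable. In the estimates |z|
    + 1 stands in for |z|, so that division is safe at [z] = 0. *)
Lemma zero_derivative_const (f : C -> C) :
  (forall z, is_C_derivative f z 0) -> forall z, f z = f 0%C.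
Proof.
  intros H z.
  replace z with (RtoC 1 * z)%C at 1 by ring.
  replace (RtoC 0) with (RtoC 0 * z)%C by ring.
  symmetry; apply (eq_is_derive (V := C_R_NormedModule) (fun t => f (RtoC t * z)%C) 0 1); [|lra].
  intros t _; split; [apply (is_linear_scal_l (V := C_R_NormedModule))|].
  intros t' Ht'; rewrite <- (is_filter_lim_locally_unique (V := R_NormedModule) _ _ Ht'); clear t' Ht'.
  intros [e He].
  assert (Hm : 0 < Cmod z + 1) by (pose proof (Cmod_ge_0 z); lra).
  destruct (is_C_derivative_eps _ _ _ (H (RtoC t * z)%C) (e / (Cmod z + 1))) as (d & Hd & K);
    [now apply Rdiv_lt_0_compat|].
  exists (mkposreal (d / (Cmod z + 1)) ltac:(now apply Rdiv_lt_0_compat)); intros s Hs.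
  change (Rabs (s - t) < d / (Cmod z + 1)) in Hs.
  apply Rlt_div_r in Hs; [|trivial].
  simpl pos; rewrite norm_Cmod, scal_R_Cmult.
  change (Cmod ((f (RtoC s * z) - f (RtoC t * z)) - RtoC (s - t) * 0)%C <= e * Rabs (s - t)).
  assert (E : Cmod (RtoC s * z - RtoC t * z) = Rabs (s - t) * Cmod z).
  { rewrite <- Cmod_R, <- Cmod_mult; f_equal; rewrite RtoC_minus; ring. }
  specialize (K (RtoC s * z)%C); rewrite E in K.
  assert (Hle : Rabs (s - t) * Cmod z <= Rabs (s - t) * (Cmod z + 1))
    by (pose proof (Rabs_pos (s - t)); nra).
  specialize (K ltac:(lra)).
  replace (f (RtoC s * z) - f (RtoC t * z) - RtoC (s - t) * 0)%C with
    (f (RtoC s * z) - f (RtoC t * z) - 0 * (RtoC s * z - RtoC t * z))%C by ring.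
  eapply Rle_trans; [exact K|].
  replace (e * Rabs (s - t)) with (e / (Cmod z + 1) * (Rabs (s - t) * (Cmod z + 1))) by (field; lra).
  apply Rmult_le_compat_l; [left; now apply Rdiv_lt_0_compat|trivial].
Qed.

(* In the coordinate [z0 + e^w], circles around [z0] become vertical segments of
   length 2 pi, on which the difference quotient of [h] has a mean independent of
   the radius: it tends to [0] for large radii and to [h'(z0)] for small ones. *)
Lemma bounded_derivative_zero (h : C -> C) (M : R) (z0 l : C) :
  holomorphic h -> (forall z, Cmod (h z) <= M) -> is_C_derivative h z0 l -> l = 0%C.
Proof.
  intros hh HM Hl; apply NNPP; intros Hne; apply Cmod_gt_0 in Hne.
  set (q := fun w => ((h (Cexp w + z0) + - h z0) * Cexp (- w))%C).
  assert (hq : holomorphic q).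
  { intros w; eexists; apply is_C_derivative_mult.
    - apply is_C_derivative_add_const.
      apply (is_C_derivative_comp h (fun w => Cexp w + z0)%C).
      + apply is_C_derivative_add_const, is_C_derivative_Cexp.
      + exact (proj2_sig (constructive_indefinite_description _ (hh (Cexp w + z0)%C))).
    - apply (is_C_derivative_comp Cexp Copp); [apply is_C_derivative_opp|apply is_C_derivative_Cexp]. }
  assert (Hper : forall x, q (x, 0) = q (x, 2 * PI)).
  { intros x; unfold q.
    assert (E : Cexp (x, 2 * PI) = Cexp (x, 0)).
    { rewrite <- (Cexp_period (x, 0)); f_equal; unfold Cplus; simpl; f_equal; ring. }
    now rewrite !Cexp_opp, E. }
  pose proof PI_RGT_0 as Hpi.
  (* The common mean will be within [e] of both [l] and 0, forcing |l| <= 2 e. *)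
  set (e := Cmod l / 3).
  destruct (is_C_derivative_eps _ _ _ Hl e ltac:(unfold e; lra)) as (d & Hd & Hs).
  assert (HM0 : 0 <= M) by (eapply Rle_trans; [apply Cmod_ge_0|apply (HM z0)]).
  (* The radii are [d / 2], inside the range of the derivative estimate, and at least
     [(2 * M + 1) / e], where a numerator of at most 2 M is outweighed. The 1 keeps the logarithm's
     argument positive when [M] = 0; [Rmax] ensures x1 <= x2. *)
  set (x1 := ln (d / 2)); set (x2 := Rmax x1 (ln ((2 * M + 1) / e))).
  assert (He : 0 < e) by (unfold e; lra).
  assert (near : forall y, Cmod (q (x1, y) - l) <= e).
  { intros y; unfold q; rewrite Cexp_opp.
    set (u := Cexp (x1, y)).
    assert (Hu : u <> 0%C) by apply Cexp_neq_0.
    assert (Eu : Cmod u = d / 2).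
    { unfold u; rewrite Cmod_Cexp; simpl; unfold x1; apply exp_ln; lra. }
    specialize (Hs (u + z0)%C); replace (u + z0 - z0)%C with u in Hs by ring.
    specialize (Hs ltac:(lra)).
    replace ((h (u + z0) + - h z0) * / u - l)%C with ((h (u + z0) - h z0 - l * u) / u)%C by (field; trivial).
    rewrite Cmod_div by trivial; apply Rle_div_l; lra. }
  assert (far : forall y, Cmod (q (x2, y) - 0) <= e).
  { intros y; unfold q; rewrite Cexp_opp.
    set (u := Cexp (x2, y)).
    assert (Hu : u <> 0%C) by apply Cexp_neq_0.
    assert (Hp : 0 < (2 * M + 1) / e) by (apply Rdiv_lt_0_compat; lra).
    assert (Eu : (2 * M + 1) / e <= Cmod u).
    { unfold u; rewrite Cmod_Cexp; simpl; rewrite <- (exp_ln _ Hp) at 1.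
      assert (L : ln ((2 * M + 1) / e) <= x2) by apply Rmax_r.
      destruct L as [L|L]; [left; now apply exp_increasing|rewrite <- L; apply Rle_refl]. }
    apply Rle_div_l in Eu; [|trivial].
    replace ((h (u + z0) + - h z0) * / u - 0)%C with ((h (u + z0) + - h z0) / u)%C by (field; trivial).
    rewrite Cmod_div by trivial; apply Rle_div_l; [now apply Cmod_gt_0|].
    eapply Rle_trans; [apply Cmod_triangle|]; rewrite Cmod_opp.
    pose proof (HM (u + z0)%C); pose proof (HM z0); lra. }
  assert (H2pi : 0 <= 2 * PI) by lra.
  pose proof (periodic_integral_const q x1 x2 (2 * PI) hq Hper H2pi (Rmax_l _ _)) as EI.
  pose proof (CInt_near_const (fun y => q (x1, y)) 0 (2 * PI) e l H2pi
    (continuous_col q hq x1) (fun y _ => near y)) as I1.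
  pose proof (CInt_near_const (fun y => q (x2, y)) 0 (2 * PI) e 0 H2pi
    (continuous_col q hq x2) (fun y _ => far y)) as I2.
  rewrite <- EI in I2; set (I := CInt (fun y => q (x1, y)) 0 (2 * PI)) in *.
  assert (F : Cmod (RtoC (2 * PI - 0) * l) <= Cmod (I - RtoC (2 * PI - 0) * l) + Cmod (I - RtoC (2 * PI - 0) * 0)).
  { rewrite <- (Cmod_opp (I - RtoC (2 * PI - 0) * l)).
    eapply Rle_trans; [|apply Cmod_triangle]; apply Req_le; f_equal; ring. }
  rewrite Cmod_mult, Cmod_R, Rabs_pos_eq in F by lra.
  replace (Cmod l) with (3 * e) in F by (unfold e; field).
  nra.
Qed.

Theorem liouville (h : C -> C) (M : R) :
  holomorphic h -> (forall z, Cmod (h z) <= M) -> forall z, h z = h 0%C.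
Proof.
  intros hh HM; apply zero_derivative_const; intros z.
  destruct (hh z) as [l Hl].
  now rewrite (bounded_derivative_zero h M z l hh HM Hl) in Hl.
Qed.

Lemma holomorphic_omitting_ball_const (g : C -> C) (c : C) (r : R) :
  0 < r -> holomorphic g -> (forall z, r <= Cmod (g z - c)) -> forall z, g z = g 0%C.
Proof.
  intros Hr hg H z.
  assert (Hn : forall z, (g z + - c)%C <> 0%C) by
    (intros y; apply Cmod_gt_0; specialize (H y); unfold Cminus in H; lra).
  assert (E : (/ (g z + - c) = / (g 0 + - c))%C).
  { apply (liouville (fun z => / (g z + - c))%C (/ r)).
    - intros y; destruct (hg y) as [l Hl]; eexists.
      apply (is_C_derivative_inv_comp (fun y => g y + - c)%C); [trivial|].
      apply is_C_derivative_add_const; exact Hl.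
    - intros y; rewrite Cmod_inv by trivial; apply Rinv_le_contravar; [trivial|apply H]. }
  replace (g z) with (/ / (g z + - c) + c)%C by (field; apply Hn).
  rewrite E; field; apply Hn.
Qed.

(** * The preimage of a simply connected region *)

(** The retraction of the line onto [0,1]. Composing with it turns relative continuity on the
    interval or the square into continuity everywhere. *)
Definition clamp (t : R) : R := Rmax 0 (Rmin 1 t).

Lemma clamp_unit (t : R) : 0 <= clamp t <= 1.
Proof. unfold clamp, Rmax, Rmin; repeat destruct Rle_dec; lra. Qed.

Lemma clamp_id (t : R) : 0 <= t <= 1 -> clamp t = t.
Proof. unfold clamp, Rmax, Rmin; repeat destruct Rle_dec; lra. Qed.

Lemma clamp_ge (t : R) : 1 <= t -> clamp t = 1.
Proof. unfold clamp, Rmax, Rmin; repeat destruct Rle_dec; lra. Qed.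

Lemma clamp_le (t : R) : t <= 0 -> clamp t = 0.
Proof. unfold clamp, Rmax, Rmin; repeat destruct Rle_dec; lra. Qed.

Lemma continuous_clamp {T : UniformSpace} (u : T -> R) (x : T) :
  continuous u x -> continuous (fun y => clamp (u y)) x.
Proof.
  intros Hu; apply continuous_comp; [exact Hu|].
  intros P [e He]; exists e; intros t Ht; apply He.
  change (Rabs (t - u x) < e) in Ht; change (Rabs (clamp t - clamp (u x)) < e).
  eapply Rle_lt_trans; [|exact Ht].
  unfold clamp, Rmax, Rmin, Rabs; repeat destruct Rle_dec; repeat destruct Rcase_abs; lra.
Qed.

(** Continuity is asked on the whole line, so that composition needs no relative topology; only the
    values on [0,1] are confined to [E]. *)
Definition path_connected_in (E : C -> Prop) (u v : C) : Prop :=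
  exists g : R -> C, (forall t, contC g t) /\ g 0 = u /\ g 1 = v /\
    forall t, 0 <= t <= 1 -> E (g t).

Lemma path_connected_in_refl (E : C -> Prop) (u : C) : E u -> path_connected_in E u u.
Proof.
  intros H; exists (fun _ => u); repeat split; trivial; intros; apply continuous_Cconst.
Qed.

Lemma path_connected_in_end (E : C -> Prop) (u v : C) : path_connected_in E u v -> E v.
Proof. intros (g & _ & _ & <- & H); apply H; lra. Qed.

Lemma path_connected_in_extend (E : C -> Prop) (u v w : C) (r : R) :
  (forall y, Cmod (y - v) < r -> E y) -> Cmod (w - v) < r ->
  path_connected_in E u v -> path_connected_in E u w.
Proof.
  intros Hr Hw (g & Hc & H0 & H1 & HE).
  assert (Haff : forall a b t : R, continuous (fun t : R => a * t + b) t).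
  { intros a b t; apply (@continuous_plus _ R_AbsRing R_NormedModule); [|apply continuous_const].
    apply continuous_Rmult; [apply continuous_const|apply continuous_id]. }
  (* First [g] at double speed, then the segment from [v] to [w]. Each [clamp] is frozen while the
     other moves, so one formula is continuous without any gluing at 1/2. *)
  exists (fun t => g (clamp (2 * t + 0)) + RtoC (clamp (2 * t + -1)) * (w - v))%C; split; [|split; [|split]].
  - intros t; apply continuous_Cplus.
    + apply (continuous_comp (V := R_UniformSpace) (fun t : R => clamp (2 * t + 0)) g); [|apply Hc].
      now apply continuous_clamp.
    + apply continuous_Cmult; [|apply continuous_Cconst].
      apply continuous_C; simpl; [now apply continuous_clamp|apply continuous_const].
  - rewrite clamp_le, clamp_le, H0 by lra; ring.
  - rewrite clamp_ge, clamp_ge, H1 by lra; ring.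
  - intros t Ht; destruct (Rle_lt_dec t (1 / 2)) as [Hl|Hl].
    + rewrite (clamp_le (_ + -1)) by lra; rewrite Cmult_0_l, Cplus_0_r; apply HE, clamp_unit.
    + rewrite (clamp_ge (_ + 0)), (clamp_id (_ + -1)), H1 by lra; apply Hr.
      replace (v + RtoC (2 * t + -1) * (w - v) - v)%C with (RtoC (2 * t + -1) * (w - v))%C by ring.
      rewrite Cmod_mult, Cmod_R, Rabs_pos_eq by lra.
      pose proof (Cmod_ge_0 (w - v)); nra.
Qed.

Section Component.
Variable E : C -> Prop.
Hypothesis hE : open (T := C_UniformSpace) E.
Variable c : C.

Lemma open_component : open (T := C_UniformSpace) (path_connected_in E c).
Proof.
  intros u Hu.
  destruct (proj1 (locally_Cmod _ _) (hE u (path_connected_in_end _ _ _ Hu))) as (r & Hr & H).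
  apply locally_Cmod; exists r; split; [trivial|]; intros w Hw.
  now apply (path_connected_in_extend E c u w r).
Qed.

(** If a point [w] within r / 2 of [u] were reachable, so would be [u]: the disc of radius r / 2
    about [w] contains [u] and lies in the disc of radius r about [u], hence in [E]. *)
Lemma open_component_compl :
  open (T := C_UniformSpace) (fun u => E u /\ ~ path_connected_in E c u).
Proof.
  intros u [Hu Hn].
  destruct (proj1 (locally_Cmod _ _) (hE u Hu)) as (r & Hr & H).
  apply locally_Cmod; exists (r / 2); split; [lra|]; intros w Hw; split; [apply H; lra|].
  intros Hc; apply Hn; apply (path_connected_in_extend E c w u (r / 2)); trivial.
  - intros y Hy; apply H.
    pose proof (Cmod_triangle (y - w) (w - u)) as T.
    replace (y - w + (w - u))%C with (y - u)%C in T by ring; lra.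
  - now rewrite Cmod_minus_sym.
Qed.
End Component.

(** The clamped point never leaves the square, so its limit can be taken in the [within] filter of
    relative continuity. The parameter plane is read as [C] to make [continuous_log] applicable. *)
Lemma continuous_clamp_homotopy (H : R * R -> C) :
  continuous_on unit_square H ->
  forall p : C, contC (fun p : C => H (clamp (fst p), clamp (snd p))) p.
Proof.
  intros Hc p.
  apply (filterlim_comp _ _ _ (fun p : C => (clamp (fst p), clamp (snd p))) H _
    (within unit_square (locally (T := prod_UniformSpace R_UniformSpace R_UniformSpace)
      (clamp (fst p), clamp (snd p))))).
  - intros P HP.
    assert (K : contC (fun p : C => (clamp (fst p), clamp (snd p))) p).
    { apply continuous_C; simpl; apply continuous_clamp; [apply continuous_fst|apply continuous_snd]. }
    specialize (K _ HP); unfold filtermap in *.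
    eapply filter_imp; [|exact K]; intros y Hy; apply Hy; split; apply clamp_unit.
  - apply Hc; split; apply clamp_unit.
Qed.

(* A path in the preimage of [D] under [a + exp] joining two points of the same
   fibre projects to a loop in [D]; a logarithm of its null-homotopy shows that
   the loop does not wind around [a]. *)
Lemma path_connected_in_fibre (D : C -> Prop) (a u v : C) :
  simply_connected D -> ~ D a -> Cexp u = Cexp v ->
  path_connected_in (fun w => D (a + Cexp w)%C) u v -> u = v.
Proof.
  intros [_ hsc] haD Huv (g & Hc & H0 & H1 & HD).
  destruct (hsc (a + Cexp u)%C (fun t => a + Cexp (g t))%C) as (H & HC & HH & HL & HR & HE).
  { split; [|split; [exact HD|split]].
    - assert (K : forall t : R, contC (fun t => a + Cexp (g t))%C t).
      { intros t; apply (continuous_Cplus (fun _ => a) (fun t => Cexp (g t)) t).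
        - apply continuous_Cconst.
        - now apply continuous_Cexp. }
      intros t _ P HP; exact (@filter_le_within _ _ (@filter_filter _ _ (locally_filter t)) unit_interval _ (K t P HP)).
    - now rewrite H0.
    - now rewrite H1, Huv. }
  set (phi := fun p : C => (H (clamp (fst p), clamp (snd p)) - a)%C).
  destruct (continuous_log phi) as (psi & Cpsi & Epsi).
  { intros p; apply continuous_Cminus; [now apply continuous_clamp_homotopy|apply continuous_Cconst]. }
  { intros p E; apply haD.
    replace a with (H (clamp (fst p), clamp (snd p))); [apply HH; split; apply clamp_unit|].
    fold (phi p); replace (H _) with (phi p + a)%C by (unfold phi; ring); rewrite E; ring. }
  assert (Ephi : forall s t, unit_interval s -> unit_interval t -> Cexp (psi (s, t)) = (H (s, t) - a)%C).
  { intros s t Hs Ht; rewrite Epsi; unfold phi; simpl; now rewrite !clamp_id by assumption. }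
  assert (U0 : unit_interval 0) by (unfold unit_interval; lra).
  assert (U1 : unit_interval 1) by (unfold unit_interval; lra).
  assert (Crow : forall s t, contC (fun t : R => psi (s, t)) t).
  { intros s t; apply (continuous_comp (V := C_UniformSpace) (fun t => (s, t) : C) psi); [|apply Cpsi].
    apply continuous_C; simpl; [apply continuous_const|apply continuous_id]. }
  assert (Ccol : forall t s, contC (fun s : R => psi (s, t)) s).
  { intros t s; apply (continuous_comp (V := C_UniformSpace) (fun s => (s, t) : C) psi); [|apply Cpsi].
    apply continuous_C; simpl; [apply continuous_id|apply continuous_const]. }
  (* On three sides of the square the homotopy rests at the base point, so [psi] is constant on each
     of them and takes the same value at all four corners. *)
  assert (E1 : psi (1, 0) = psi (0, 0)).
  { apply (Cexp_path_const (fun s => psi (s, 0))); [intros; apply Ccol|].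
    intros s Hs; rewrite !Ephi by assumption.
    now rewrite (proj1 (HE s Hs)), (proj1 (HE 0 U0)). }
  assert (E2 : psi (1, 1) = psi (0, 1)).
  { apply (Cexp_path_const (fun s => psi (s, 1))); [intros; apply Ccol|].
    intros s Hs; rewrite !Ephi by assumption.
    now rewrite (proj2 (HE s Hs)), (proj2 (HE 0 U0)). }
  assert (E3 : psi (1, 1) = psi (1, 0)).
  { apply (Cexp_path_const (fun t => psi (1, t))); [intros; apply Crow|].
    intros t Ht; rewrite !Ephi by assumption; now rewrite !HR by assumption. }
  (* On the remaining side [psi] and [g] are logarithms of the same loop, so they differ by a
     constant and [g] closes up as [psi] does. *)
  assert (E4 : (psi (0, 1) - g 1 = psi (0, 0) - g 0)%C).
  { apply (Cexp_path_const (fun t => psi (0, t) - g t)%C).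
    - intros t _; now apply continuous_Cminus.
    - intros t Ht; rewrite !Cexp_minus, !Ephi, !HL by assumption.
      field; split; apply Cexp_neq_0. }
  rewrite <- H0, <- H1.
  replace (g 1) with (psi (0, 1) - (psi (0, 1) - g 1))%C by ring.
  rewrite E4, <- E2, E3, E1; ring.
Qed.

Lemma open_preimage (h : C -> C) (U : C -> Prop) :
  (forall z, contC h z) -> open (T := C_UniformSpace) U ->
  open (T := C_UniformSpace) (fun z => U (h z)).
Proof. intros Hh HU z Hz; exact (Hh z U (HU _ Hz)). Qed.

Lemma holomorphic_omitting_open_const (g : C -> C) (U : C -> Prop) (c : C) :
  holomorphic g -> open (T := C_UniformSpace) U -> U c -> (forall z, ~ U (g z)) ->
  forall z, g z = g 0%C.
Proof.
  intros hg HU Hc Hn.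
  destruct (proj1 (locally_Cmod _ _) (HU c Hc)) as (r & Hr & H).
  apply (holomorphic_omitting_ball_const g c r Hr hg).
  intros z; apply Rnot_lt_le; intros L; exact (Hn z (H _ L)).
Qed.

Theorem theorem1 (f : C -> C) (a : C) (D : C -> Prop)
  (hf : transcendental_entire f)
  (ha : forall z : C, f z <> a)
  (hD : region D)
  (hsc : simply_connected D)
  (haD : ~ D a) :
  ~ connected_set (T := C_UniformSpace) (fun z : C => D (f z)).
Proof.
  intros Hconn.
  destruct hf as [hent hpoly]; destruct hD as ((w0 & Hw0) & hopen & _).
  assert (hfm : holomorphic (fun z => f z + - a)%C).
  { intros z; destruct (hent z) as [l Hl]; exists l.
    now apply is_C_derivative_add_const, is_derive_is_C_derivative. }
  destruct (continuous_log (fun z => f z + - a)%C) as (g & Cg & Eg).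
  { now apply holomorphic_continuous. }
  { intros z; apply Cminus_neq_0, ha. }
  assert (hg : holomorphic g) by now apply (holomorphic_log _ _ hfm).
  assert (Ef : forall z, f z = (a + Cexp (g z))%C) by (intros z; rewrite Eg; ring).
  (* A constant [g] would make [f] a polynomial of degree 0. *)
  assert (hnc : ~ forall z, g z = g 0%C).
  { intros K; apply hpoly; exists 0%nat, (fun _ => f 0%C); intros z.
    rewrite sum_O, (Ef z), K, <- Ef; simpl; ring. }
  destruct (Cexp_surj (w0 - a)%C) as [c Hc].
  { apply Cminus_neq_0; intros ->; contradiction. }
  set (E := fun w => D (a + Cexp w)%C).
  assert (HE : open (T := C_UniformSpace) E).
  { apply (open_preimage (fun w => a + Cexp w)%C); [|exact hopen].
    intros w; apply (continuous_Cplus (fun _ => a)); [apply continuous_Cconst|].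
    apply continuous_Cexp, continuous_id. }
  assert (Ec : E c) by (unfold E; rewrite Hc; now replace (a + (w0 - a))%C with w0 by ring).
  set (E0 := path_connected_in E c); set (E1 := fun u => E u /\ ~ E0 u).
  assert (HE0 : open (T := C_UniformSpace) E0) by now apply open_component.
  assert (HE1 : open (T := C_UniformSpace) E1) by now apply open_component_compl.
  (* Membership in [E] is the period of exp. A path from [c] would join two distinct points of one
     fibre, against [path_connected_in_fibre]. *)
  assert (Ec1 : E1 (c + (0, (2 * PI)%R))%C).
  { split.
    - unfold E; now rewrite Cexp_period.
    - intros K; apply path_connected_in_fibre in K; trivial; [|now rewrite Cexp_period].
      apply (f_equal snd) in K; simpl in K; pose proof PI_RGT_0; lra. }
  destruct (classic (exists z, E0 (g z))) as [[z0 Z0]|N0].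
  - destruct (classic (exists z, E1 (g z))) as [[z1 Z1]|N1].
    + destruct (Hconn (fun z => E0 (g z)) (fun z => E1 (g z))) as (z & _ & K0 & K1).
      * now apply open_preimage.
      * now apply open_preimage.
      * intros z Hz; rewrite Ef in Hz; unfold E1.
        destruct (classic (E0 (g z))); [now left|right; now split].
      * exists z0; split; [|exact Z0]; rewrite Ef; exact (path_connected_in_end _ _ _ Z0).
      * exists z1; split; [|exact Z1]; rewrite Ef; exact (proj1 Z1).
      * exact (proj2 K1 K0).
    + apply hnc, (holomorphic_omitting_open_const g E1 _ hg HE1 Ec1).
      intros z Hz; apply N1; now exists z.
  - apply hnc, (holomorphic_omitting_open_const g E0 c hg HE0).
    + now apply path_connected_in_refl.
    + intros z Hz; apply N0; now exists z.
Qed.
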